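(* Let $H$ be a finitely generated group, let $\mathrm{Sym}(H)$ be the group of finitary permutations of the set $H$, and let $G=\mathrm{Sym}(H)\rtimes H$ be the extension of this group by $H$. Then the Følner function of $G$ is asymptotically greater than or equal to $v_H(n)^{v_H(n)}$, that is, $v_H(n)^{v_H(n)}\preceq \mathrm{F\o l}_G(n)$.
   Context: A finitary permutation is one with finite support. $H$ acts on $\mathrm{Sym}(H)$ via translation of the underlying set $H$; $G$ is finitely generated (by the transpositions $(e,s)$, $s\in S$, together with $S$, where $S$ is a finite symmetric generating set of $H$). $v_H(n)$ is the growth function of $H$: the number of elements of word length $\le n$ with respect to a finite generating set. For a group $G$ with finite symmetric generating set $S$ and word metric $d_S$, $\partial_S V$ is the set of $v\in V$ at $d_S$-distance one from $G\setminus V$, and $\mathrm{F\o l}_{G,S}(n)$ is the minimum of $\#V$ over finite non-empty $V\subset G$ with $\#\partial_SV/\#V\le1/n$ ($+\infty$ if none exists). For functions, $f_1\preceq f_2$ means there are positive constants $C,K$ with $f_1(x)\le Cf_2(Kx)$ for all $x$; $f_1\simeq f_2$ means $f_1\preceq f_2$ and $f_2\preceq f_1$. The $\simeq$-classes of $\mathrm{F\o l}_{G,S}$ and of the growth function do not depend on the generating sets, and are denoted $\mathrm{F\o l}_G$, $v_H$. *)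

(* Defs.v *)
From HB Require Import structures.
From mathcomp Require Import all_boot all_order all_algebra finmap.
From mathcomp Require Import all_classical all_reals ereal.

Set Implicit Arguments.
Unset Strict Implicit.
Unset Printing Implicit Defensive.

Import Order.TTheory GRing.Theory Num.Theory.

Local Open Scope fset_scope.
Local Open Scope classical_set_scope.
Local Open Scope ring_scope.
Local Open Scope group_scope.

Section FinitaryPermutations.
Variable X : choiceType.

Record finperm := FinPerm {
  fp_fun :> X -> X;
  fp_inv : X -> X;
  fp_funK : cancel fp_fun fp_inv;
  fp_invK : cancel fp_inv fp_fun;
  fp_finite : finite_set [set x | fp_fun x <> x]
}.

Lemma finpermP (s t : finperm) : s =1 t -> s = t.
Proof.
case: s t => [f f' fK f'K ff] [g g' gK g'K gf] /= /funext efg.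
subst g; have efg' : f' = g' by apply/funext => x; rewrite -[in LHS](g'K x) fK.
by subst g'; congr FinPerm; exact: Prop_irrelevance.
Qed.

Lemma finperm_one_finite : finite_set [set x : X | id x <> x].
Proof. by rewrite (_ : mkset _ = set0)//; apply/seteqP; split=> x //=; apply. Qed.

Definition finperm_one :=
  @FinPerm id id (fun=> erefl) (fun=> erefl) finperm_one_finite.

Lemma finperm_mul_finite (s t : finperm) :
  finite_set [set x | s (t x) <> x].
Proof.
have : finite_set ([set x | s x <> x] `|` [set x | t x <> x]).
  by rewrite finite_setU; split; exact: fp_finite.
apply: sub_finite_set => x /= stx.
by have [tx|] := pselect (t x = x); [left; move: stx; rewrite tx|right].
Qed.

Definition finperm_mul (s t : finperm) := FinPerm
  (can_comp (fp_funK s) (fp_funK t)) (can_comp (fp_invK t) (fp_invK s))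
  (finperm_mul_finite s t).

Lemma finperm_inv_finite (s : finperm) : finite_set [set x | fp_inv s x <> x].
Proof.
apply: sub_finite_set (fp_finite s) => x /= sx sx'.
by apply: sx; rewrite -{1}sx' fp_funK.
Qed.

Definition finperm_inv (s : finperm) :=
  FinPerm (fp_invK s) (fp_funK s) (finperm_inv_finite s).

HB.instance Definition _ := gen_eqMixin finperm.
HB.instance Definition _ := gen_choiceMixin finperm.

Lemma finperm_mulA : associative finperm_mul.
Proof. by move=> s t u; exact: finpermP. Qed.
Lemma finperm_mul1 : left_id finperm_one finperm_mul.
Proof. by move=> s; exact: finpermP. Qed.
Lemma finperm_1mul : right_id finperm_one finperm_mul.
Proof. by move=> s; exact: finpermP. Qed.
Lemma finperm_mulV : left_inverse finperm_one finperm_inv finperm_mul.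
Proof. by move=> s; apply: finpermP => x /=; rewrite fp_funK. Qed.
Lemma finperm_Vmul : right_inverse finperm_one finperm_inv finperm_mul.
Proof. by move=> s; apply: finpermP => x /=; rewrite fp_invK. Qed.

HB.instance Definition _ := isGroup.Build finperm
  finperm_mulA finperm_mul1 finperm_1mul finperm_mulV finperm_Vmul.

Lemma finpermM (s t : finperm) x : (s * t) x = s (t x). Proof. by []. Qed.

Definition transp_fun (a b x : X) :=
  if x == a then b else if x == b then a else x.

Lemma transp_funK a b : involutive (transp_fun a b).
Proof.
move=> x; rewrite /transp_fun.
have [->|xa] := eqVneq x a; first by rewrite eqxx; case: eqVneq.
by have [->|xb] := eqVneq x b; rewrite ?eqxx// (negbTE xa) (negbTE xb).
Qed.

Lemma transp_finite a b : finite_set [set x | transp_fun a b x <> x].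
Proof.
apply: sub_finite_set (finite_set2 a b) => x /=; rewrite /transp_fun.
by case: eqVneq => [->|_]; [left|case: eqVneq => [->|//]; right].
Qed.

Definition transp (a b : X) : finperm :=
  FinPerm (transp_funK a b) (transp_funK a b) (transp_finite a b).

End FinitaryPermutations.

Record group_act (H N : groupType) := GroupAct {
  gact :> H -> N -> N;
  gact1 : forall n, gact 1 n = n;
  gactM : forall h k n, gact (h * k) n = gact h (gact k n);
  gact_morph : forall h, {morph gact h : n m / n * m}
}.

(* A record rather than an alias of N * H, which carries the direct product *)
(* group structure.                                                         *)
Record sdprod (H N : groupType) (a : group_act H N) :=
  SDProd { sd_fst : N; sd_snd : H }.

Section SemidirectProduct.
Variables (H N : groupType) (a : group_act H N).

HB.instance Definition _ := gen_eqMixin (sdprod a).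
HB.instance Definition _ := gen_choiceMixin (sdprod a).

Definition sd_one : sdprod a := SDProd a 1 1.
Definition sd_mul (x y : sdprod a) : sdprod a :=
  SDProd a (sd_fst x * a (sd_snd x) (sd_fst y)) (sd_snd x * sd_snd y).
Definition sd_inv (x : sdprod a) : sdprod a :=
  SDProd a (a (sd_snd x)^-1 (sd_fst x)^-1) (sd_snd x)^-1.

Lemma gact_one h : a h 1 = 1.
Proof. by apply: (mulgI (a h 1)); rewrite -gact_morph !mulg1. Qed.

Lemma sd_mulA : associative sd_mul.
Proof.
by move=> [n h] [m k] [p l]; rewrite /sd_mul /= gact_morph gactM !mulgA.
Qed.
Lemma sd_mul1 : left_id sd_one sd_mul.
Proof. by move=> [n h]; rewrite /sd_mul /= gact1 !mul1g. Qed.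
Lemma sd_1mul : right_id sd_one sd_mul.
Proof. by move=> [n h]; rewrite /sd_mul /= gact_one !mulg1. Qed.
Lemma sd_mulV : left_inverse sd_one sd_inv sd_mul.
Proof.
by move=> [n h]; rewrite /sd_mul /sd_inv /= -gact_morph !mulVg gact_one.
Qed.
Lemma sd_Vmul : right_inverse sd_one sd_inv sd_mul.
Proof.
by move=> [n h]; rewrite /sd_mul /sd_inv /= -gactM !mulgV gact1 mulgV.
Qed.

HB.instance Definition _ :=
  isGroup.Build (sdprod a) sd_mulA sd_mul1 sd_1mul sd_mulV sd_Vmul.

End SemidirectProduct.

Section TranslationAction.
Variable H : groupType.

Lemma translate_finite (h : H) (s : finperm H) :
  finite_set [set x | h * s (h^-1 * x) <> x].
Proof.
apply: sub_finite_set (finite_image (fun x => h * x) (fp_finite s)) => x /= sx.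
by exists (h^-1 * x); rewrite ?mulVKg// => sx'; apply: sx; rewrite sx' mulVKg.
Qed.

Lemma translateK (h : H) (s : finperm H) :
  cancel (fun x => h * s (h^-1 * x)) (fun x => h * fp_inv s (h^-1 * x)).
Proof. by move=> x; rewrite mulKg fp_funK mulVKg. Qed.

Lemma translateKV (h : H) (s : finperm H) :
  cancel (fun x => h * fp_inv s (h^-1 * x)) (fun x => h * s (h^-1 * x)).
Proof. by move=> x; rewrite mulKg fp_invK mulVKg. Qed.

Definition translate (h : H) (s : finperm H) : finperm H :=
  FinPerm (translateK h s) (translateKV h s) (translate_finite h s).

Lemma translate1 s : translate 1 s = s.
Proof. by apply: finpermP => x /=; rewrite invg1 !mul1g. Qed.
Lemma translate_one h : translate h 1 = 1.
Proof. by apply: finpermP => x /=; rewrite mulVKg. Qed.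
Lemma translateM h k s : translate (h * k) s = translate h (translate k s).
Proof. by apply: finpermP => x /=; rewrite invgM !mulgA. Qed.
Lemma translate_morph h : {morph translate h : s t / s * t}.
Proof. by move=> s t; apply: finpermP => x /=; rewrite mulKg. Qed.

Definition translation : group_act H (finperm H) :=
  GroupAct translate1 translateM translate_morph.

End TranslationAction.

Definition sym_ext (H : groupType) : groupType := sdprod (translation H).

Section WordMetric.
Variables (G : groupType) (S : {fset G}).

Definition spells (w : seq G) (g : G) : Prop :=
  {subset w <= S} /\ \prod_(s <- w) s = g.

Definition symmetric_generating : Prop :=
  (forall s, s \in S -> s^-1 \in S) /\ (forall g, exists w, spells w g).

(* The default value 0 is only reached when no word in S spells g. *)
Definition word_length (g : G) : nat :=
  xget 0%N [set n | (exists2 w, spells w g & size w = n) /\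
                    (forall w, spells w g -> (n <= size w)%N)].

Definition word_dist (g h : G) : nat := word_length (g^-1 * h).

Definition boundary (V : {fset G}) : {fset G} :=
  [fset v in V | `[< exists2 w, w \notin V & word_dist v w = 1%N >]].

Definition growth (R : realType) (x : R) : nat :=
  #|` fset_set [set g | ((word_length g)%:R <= x)%R]|.

(* The infimum is over a set of natural numbers, hence is a minimum unless *)
(* that set is empty, when it is +oo.                                      *)
Definition folner (R : realType) (x : R) : \bar R :=
  ereal_inf [set (#|` V|%:R)%:E | V in [set V : {fset G} |
    V != fset0 /\ (#|` boundary V|%:R / #|` V|%:R <= x^-1 :> R)%R]].

End WordMetric.

(* Functions are compared on the positive reals so that the constant K may *)
(* be any positive real.                                                   *)
Definition asymp_le (R : realType) (f1 f2 : R -> \bar R) : Prop :=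
  exists C K : R, [/\ (0 < C)%R, (0 < K)%R &
    forall x : R, (0 < x)%R -> (f1 x <= C%:E * f2 (K * x)%R)%E].

Section WordMetricTheory.
Variables (G : groupType) (S : {fset G}).

Lemma word_lengthP g : (exists w, spells S w g) ->
  (exists2 w, spells S w g & size w = word_length S g) /\
  (forall w, spells S w g -> (word_length S g <= size w)%N).
Proof.
move=> [w0 w0g]; rewrite /word_length.
pose P n := `[< exists2 w, spells S w g & size w = n >].
have exP : exists n, P n by exists (size w0); apply/asboolP; exists w0.
case: xgetP => [n -> //|/(_ (ex_minn exP))[]].
case: ex_minnP => n /asboolP Pn min_n; split=> // w wg.
by apply: min_n; apply/asboolP; exists w.
Qed.

Lemma finite_words n : finite_set [set w | {subset w <= S} /\ size w = n].
Proof.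
elim: n => [|n IHn].
  by apply: sub_finite_set (finite_set1 [::]) => w [_ /eqP/nilP].
apply: sub_finite_set
  (finite_image (fun p => p.1 :: p.2) (finite_setX (finite_fset S) IHn)).
move=> [|s w] [] //= sub [szw]; exists (s, w) => //; split => /=.
  by apply: sub; exact: mem_head.
by split=> // t tw; apply: sub; rewrite inE tw orbT.
Qed.

Lemma finite_ball (R : realType) (x : R) : symmetric_generating S ->
  finite_set [set g | ((word_length S g)%:R <= x)%R].
Proof.
move=> [_ genS].
have [m xm] : exists m : nat, (x < m%:R)%R.
  exists (Num.bound `|x|%R); apply: le_lt_trans (ler_norm x) _.
  exact: archi_boundP (normr_ge0 x).
have fin : finite_set (\bigcup_(n in `I_m)
    ((fun w => \prod_(s <- w) s) @` [set w | {subset w <= S} /\ size w = n])).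
  by apply: bigcup_finite => // n _; exact/finite_image/finite_words.
apply: sub_finite_set fin => g /= gx.
have [[w [wS wg] szw] _] := word_lengthP (genS g).
exists (word_length S g); last by exists w.
by rewrite /= -(ltr_nat R); exact: le_lt_trans gx xm.
Qed.

Lemma spells1 : spells S [::] 1.
Proof. by split=> //; rewrite big_nil. Qed.

Lemma spellsM v w g h : spells S v g -> spells S w h -> spells S (v ++ w) (g * h).
Proof.
move=> [vS <-] [wS <-]; split; last by rewrite big_cat.
by move=> s; rewrite mem_cat => /orP[/vS|/wS].
Qed.

Lemma spells_mem s : s \in S -> spells S [:: s] s.
Proof. by move=> sS; split; [move=> t /[!inE]/eqP->|rewrite big_seq1]. Qed.

End WordMetricTheory.

Section StandardGenerators.
Variable H : groupType.

Definition std_gen (S : {fset H}) : {fset sym_ext H} :=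
  ([fset SDProd (translation H) (transp 1 s) 1 | s in S] `|`
   [fset SDProd (translation H) 1 s | s in S])%fset.

Lemma transp1 (X : choiceType) (a : X) : transp a a = 1.
Proof.
by apply: finpermP => x /=; rewrite /transp_fun; case: eqVneq => [->|].
Qed.

Lemma transpC (X : choiceType) (a b : X) : transp a b = transp b a.
Proof.
apply: finpermP => x /=; rewrite /transp_fun.
by case: (eqVneq x a) => // ->; case: eqVneq.
Qed.

Lemma transpJ (X : choiceType) (s : finperm X) a b :
  s * transp a b * s^-1 = transp (s a) (s b).
Proof.
apply: finpermP => x; rewrite !finpermM /= /transp_fun.
have sVE y : (fp_inv s x == y) = (x == s y).
  by apply/eqP/eqP => [<-|->]; rewrite ?fp_invK ?fp_funK.
by rewrite !sVE; do 2?case: ifP => // _; rewrite fp_invK.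
Qed.

Lemma finperm_ind (X : choiceType) (P : finperm X -> Prop) :
  P 1 -> (forall a b s, P s -> P (transp a b * s)) -> forall s, P s.
Proof.
move=> P1 PM s; have [n] := ubnP #|` fset_set [set x | s x <> x]|.
elim: n s => // n IHn s; rewrite ltnS => les.
have [s1|] := pselect (forall x, s x = x).
  by rewrite (_ : s = 1)//; exact: finpermP.
move=> /existsNP[a sa].
rewrite (_ : s = transp a (s a) * (transp a (s a) * s)); last first.
  by apply: finpermP => x; rewrite !finpermM /= transp_funK.
have suppE (t : finperm X) x :
    (x \in fset_set [set x | t x <> x]) = (t x != x).
  rewrite in_fset_set; last exact: fp_finite.
  by apply/idP/idP => [|/eqP]; rewrite inE => // /eqP.
apply/PM/IHn/(leq_trans _ les)/fproper_ltn_card/andP; split.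
  apply/fsubsetP => x; rewrite !suppE; apply: contra => /eqP sx.
  rewrite finpermM sx /= /transp_fun; case: (eqVneq x a) => [xa|_].
    by rewrite -xa sx.
  case: (eqVneq x (s a)) => // xsa; case: sa; apply: (can_inj (fp_funK s)).
  by rewrite -xsa.
apply/fsubsetPn; exists a; rewrite suppE; first exact/eqP.
by rewrite negbK finpermM /= /transp_fun; case: (eqVneq (s a) a); rewrite ?eqxx.
Qed.

Lemma std_gen_symmetric_generating (S : {fset H}) :
  symmetric_generating S -> symmetric_generating (std_gen S).
Proof.
move=> [symS genS]; split.
  move=> g; rewrite !inE => /orP[] /imfsetP[s /= sS ->]; apply/orP.
    left; apply/imfsetP; exists s => //=.
    by congr SDProd; rewrite /= ?invg1 ?translate1//; exact: finpermP.
  right; apply/imfsetP; exists s^-1; first exact: symS.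
  by congr SDProd; apply: finpermP => x; rewrite /= mulVKg.
pose gen (g : sym_ext H) := exists w, spells (std_gen S) w g.
have gen1 : gen 1 by exists [::]; exact: spells1.
have genM g h : gen g -> gen h -> gen (g * h).
  by move=> [v vg] [w wh]; exists (v ++ w); exact: spellsM.
pose inr h := SDProd (translation H) 1 h.
pose inl s := SDProd (translation H) s 1.
have inrM h k : inr (h * k) = inr h * inr k.
  by congr SDProd; rewrite /= translate_one mulg1.
have inlM s t : inl (s * t) = inl s * inl t.
  by congr SDProd; rewrite /= ?translate1 ?mulg1.
have gen_inr h : gen (inr h).
  have [w [wS <-]] := genS h; elim: w wS => [|s w IHw] wS.
    by rewrite big_nil.
  rewrite big_cons inrM; apply: genM; last first.
    by apply: IHw => t tw; apply: wS; rewrite inE tw orbT.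
  exists [:: inr s]; apply: spells_mem; rewrite !inE; apply/orP; right.
  by apply/imfsetP; exists s => //; apply: wS; exact: mem_head.
have gen_edge h s : s \in S -> gen (inl (transp h (h * s))).
  move=> sS; rewrite (_ : inl _ = inr h * inl (transp 1 s) * inr h^-1).
    apply/genM/gen_inr/genM; first exact: gen_inr.
    exists [:: inl (transp 1 s)]; apply: spells_mem; rewrite !inE; apply/orP.
    by left; apply/imfsetP; exists s.
  congr SDProd; rewrite /= ?translate_one ?mulg1 ?mulgV// ?mul1g.
  apply: finpermP => x /=; rewrite /transp_fun.
  have E y : (h^-1 * x == y) = (x == h * y).
    by apply/eqP/eqP => [<-|->]; rewrite ?mulVKg ?mulKg.
  by rewrite !E mulg1; case: ifP => // _; case: ifP => // _; rewrite ?mulg1 ?mulVKg.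
have gen_transp h k : gen (inl (transp h k)).
  rewrite -(mulVKg h k); have [w [wS <-]] := genS (h^-1 * k).
  elim/last_ind: w wS => [|w s IHw] wS; first by rewrite big_nil mulg1 transp1.
  have sS : s \in S by apply: wS; rewrite mem_rcons mem_head.
  have /IHw genw : {subset w <= S}.
    by move=> t tw; apply: wS; rewrite mem_rcons inE tw orbT.
  rewrite -cats1 big_cat big_seq1 mulgA; move: genw.
  set b := h * _ => genw; have := gen_edge b s sS; set c := b * s => gbc.
  have [<-|hc] := eqVneq h c; first by rewrite transp1.
  have [->//|hb] := eqVneq h b.
  rewrite (_ : transp h c = transp b c * transp h b * transp b c).
    by rewrite !inlM; apply/genM/gbc/genM.
  have := transpJ (transp b c) h b.
  rewrite /= {1 2}/transp_fun (negbTE hb) (negbTE hc) eqxx => <-.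
  by congr (_ * _); exact: finpermP.
case=> s h; rewrite (_ : SDProd _ s h = inl s * inr h); last first.
  by congr SDProd; rewrite /= ?translate_one ?mulg1 ?mul1g.
apply/genM; last exact: gen_inr.
elim/finperm_ind: s => [//|a b s gs].
by rewrite inlM; apply: genM.
Qed.

End StandardGenerators.

(* Main.v *)
Require Import Defs.
From mathcomp Require Import all_boot all_order all_algebra finmap.
From mathcomp Require Import all_classical all_reals ereal.
From mathcomp Require Import zify lra.

(** Why a Folner set of [sym_ext H] must be large.

    Let [V] be a finite set with small boundary.  Right multiplication by an
    element of length [l] moves at most [l * #|boundary V|] points of [V] out of
    [V] ([escape_boundary]).  The star swaps, i.e. the transpositions [(1 h)],
    have length at most a constant times [|h|] ([star_swap_length]), so if the
    boundary ratio of [V] is below [1 / (K x)] with [K] large, then on average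
    over [v] in [V] at least half of the star swaps with [|h| <= 256 x] keep [v]
    inside [V].  Deleting vertices of low degree turns this average into a
    minimum ([min_inner_degree]): some nonempty [W] included in [V] has at every
    point at least [d] star swaps staying in [W], provided that [d] is at most
    a quarter of the number of star swaps used.

    Right multiplication by [(1 h)] does not change the [H]-coordinate [y] and
    multiplies the permutation by [(y yh)]; so a fibre of [W] is a set of
    permutations in which every element has [d] neighbours under transpositions
    with a common centre.  Such a set has at least [d!] elements
    ([fact_le_star]): a neighbour of [s0] is recognised by the place to which it
    moved the value held by the centre, and the elements holding that value at
    that place form a set of the same kind with [d - 1] in place of [d].

    It remains to reach [v(x) ^ v(x)] from [d!].  Since [(2 k)! >= k ^ k], it is
    enough that [d >= 2 v(x)], and this follows from the growth of balls in an
    infinite group, where multiplying the radius by 4 at least doubles the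
    cardinal ([growth_doubling]).  If [H] is finite, [v ^ v] is bounded and the
    multiplicative constant takes care of it. *)

Import Order.TTheory GRing.Theory Num.Theory.

Set Implicit Arguments.
Unset Strict Implicit.
Unset Printing Implicit Defensive.

(** * Subgraphs of large minimum degree *)

Section MinimumDegree.
Variables X I : choiceType.
Variables (f : I -> X -> X) (B : {fset I}).
Hypothesis f_invol : forall i, involutive (f i).

Definition inner_degree (V : {fset X}) (v : X) : nat :=
  \sum_(i <- B) (f i v \in V).

(** As every [f i] is an involution, the edges from the rest of [V] into [v] are
    the reverses of the edges from [v] into [V]; hence the factor 2. *)
Lemma inner_degree_sum_del (V : {fset X}) (v : X) : v \in V ->
  \sum_(u <- V) inner_degree V u <=
  \sum_(u <- (V `\ v)%fset) inner_degree (V `\ v)%fset u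
    + 2 * inner_degree V v.
Proof.
move=> vV; rewrite (big_fsetD1 v) //= mul2n -addnn addnCA leq_add2l.
have split_deg u : inner_degree V u <=
    inner_degree (V `\ v)%fset u + \sum_(i <- B) (f i u == v).
  rewrite -big_split /=; apply: leq_sum => i _.
  by rewrite !inE; case: eqP; case: (_ \in V).
apply: leq_trans (leq_sum _ (fun u _ => split_deg u)) _.
rewrite big_split /= leq_add2l exchange_big /=.
apply: leq_sum => i _.
rewrite (eq_bigr (fun u => (u == f i v) : nat)) => [|u _]; last first.
  by rewrite (can2_eq (f_invol i) (f_invol i)).
rewrite -big_mkcond /= sum1_count.
rewrite count_uniq_mem ?fset_uniq //.
by rewrite inE; case: (_ \in V); rewrite ?andbF ?leq_b1.
Qed.

(** Deleting a vertex of degree less than [d] costs less than [2 * d] in the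
    total degree, so the hypothesis on the average survives, strictly; in
    particular the total stays positive and the process cannot empty [V]. *)
Lemma min_inner_degree (d : nat) (V : {fset X}) : V != fset0 ->
    2 * d * #|` V| <= \sum_(v <- V) inner_degree V v ->
  exists W : {fset X}, [/\ (W `<=` V)%fset, W != fset0 &
    forall v, v \in W -> d <= inner_degree W v].
Proof.
have [n] := ubnP #|` V|; elim: n V => // n IHn V; rewrite ltnS => leVn V0 degV.
have [degs|] := pselect (forall v, v \in V -> d <= inner_degree V v).
  by exists V; split.
move=> /existsNP[v /not_implyP[vV /negP]]; rewrite -ltnNge => dv.
have cardV := cardfsD1 v V; rewrite vV in cardV.
have del := inner_degree_sum_del vV.
have E : 2 * d * #|` (V `\ v)%fset| <
    \sum_(u <- (V `\ v)%fset) inner_degree (V `\ v)%fset u.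
  by move: cardV del degV dv; nia.
have V1 : (V `\ v)%fset != fset0.
  by apply/eqP => V1; move: E; rewrite V1 big_seq_fset0 ltn0.
have [|W [sub W0 degW]] := IHn _ _ V1 (ltnW E); first by lia.
by exists W; split => //; exact: fsubset_trans sub (fsubD1set _ _).
Qed.

End MinimumDegree.

(** * Permutations linked by transpositions with a common centre *)

Section StarTranspositions.
Variable X : choiceType.

(** Induction on [m], by slicing [W] according to the position [h] of the value
    [c] that a fixed [s0] in [W] holds at the centre.  Each [h] with
    [s0 * (e h)] in [W] gives a nonempty slice.  A swap [(e k)] with [k <> h]
    leaves [h] alone, hence preserves the slice, so only one swap is lost there.
    The slices are disjoint, since an injective map takes the value [c] once. *)
Lemma fact_le_star (e : X) (B : {fset X}) (m : nat) (W : {fset finperm X}) :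
    e \notin B -> W != fset0 ->
    (forall s, s \in W -> m <= \sum_(h <- B) ((s * transp e h)%g \in W)) ->
  m`! <= #|` W|.
Proof.
move=> eB; elim: m W => [|m IHm] W W0 degW; first by rewrite cardfs_gt0.
have /fset0Pn[s0 s0W] := W0.
pose c := s0 e.
pose slice h := [fset s in W | s h == c]%fset.
have slice_card h : h \in B -> (s0 * transp e h)%g \in W -> m`! <= #|` slice h|.
  move=> hB s0h; have he : h == e = false by apply: contraNF eB => /eqP <-.
  apply: IHm.
    apply/fset0Pn; exists (s0 * transp e h)%g.
    by rewrite !inE s0h /= /transp_fun he eqxx /=.
  move=> s; rewrite !inE => /andP[sW /eqP sh].
  have := degW s sW; rewrite !(big_fsetD1 h hB) /= => le_m.
  rewrite -ltnS; apply: (leq_trans le_m).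
  rewrite -add1n; apply: leq_add; first exact: leq_b1.
  apply: leq_trans (leq_addl _ _).
  rewrite big_seq [leqRHS]big_seq; apply: leq_sum => k.
  rewrite !inE => /andP[kh _].
  by rewrite /= /transp_fun he [h == k]eq_sym (negbTE kh) sh eqxx andbT.
apply: (@leq_trans (\sum_(h <- B) #|` slice h|)).
  rewrite factS.
  apply: leq_trans (leq_mul (degW s0 s0W) (leqnn _)) _.
  rewrite big_distrl /= big_seq [leqRHS]big_seq; apply: leq_sum => h hB.
  by case: (boolP (_ \in W)) => [/(slice_card h hB)|_]; rewrite ?mul1n.
under eq_bigr do rewrite card_fset_sum1 big_fset /= big_mkcond /=.
rewrite exchange_big /= card_fset_sum1; apply: leq_sum => s _.
rewrite -big_mkcond sum1_count.
rewrite (@eq_count _ _ (pred1 (fp_inv s c))) => [|h /=].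
  by rewrite count_uniq_mem ?fset_uniq // leq_b1.
exact: can2_eq (fp_funK s) (fp_invK s) _ _.
Qed.

End StarTranspositions.

(** The factors [k + 1, ..., 2 k] of [(2 k)!] all exceed [k]. *)
Lemma expn_le_fact_double k : k ^ k <= (2 * k)`!.
Proof.
suff le_fact j : k ^ j <= (j + k)`! by rewrite mul2n -addnn.
elim: j => [|j IHj]; first by rewrite expn0 fact_gt0.
rewrite expnS addSn factS; apply: leq_mul => //; lia.
Qed.

(** * Word length and boundary *)

Lemma sum_bool_card {X : choiceType} (V : {fset X}) (P : pred X) :
  \sum_(v <- V) P v = #|` [fset v in V | P v]%fset|.
Proof. by rewrite card_fset_sum1 -big_fset_condE [RHS]big_mkcond. Qed.

Section WordLength.
Variables (G : groupType) (S : {fset G}).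
Hypothesis gen_S : symmetric_generating S.

Lemma word_length_le (w : seq G) :
  {subset w <= S} -> word_length S (\prod_(s <- w) s)%g <= size w.
Proof.
move=> wS; have [_] := word_lengthP (gen_S.2 (\prod_(s <- w) s)%g).
by apply.
Qed.

Lemma word_length_spelled (g : G) :
  exists w, [/\ {subset w <= S}, (\prod_(s <- w) s)%g = g &
                size w = word_length S g].
Proof.
by have [[w [wS wg] szw] _] := word_lengthP (gen_S.2 g); exists w.
Qed.

Lemma word_length1 : word_length S 1%g = 0.
Proof.
apply/eqP; rewrite -leqn0.
by have := @word_length_le [::]; rewrite big_nil; apply.
Qed.

Lemma word_length_eq0 (g : G) : word_length S g = 0 -> g = 1%g.
Proof.
have [w [_ <- <-]] := word_length_spelled g.
by move=> /size0nil ->; rewrite big_nil.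
Qed.

Lemma word_length_mem (s : G) : s \in S -> word_length S s <= 1.
Proof.
move=> sS; have := @word_length_le [:: s]; rewrite big_seq1; apply => t.
by rewrite inE => /eqP ->.
Qed.

Lemma word_lengthM (g h : G) :
  word_length S (g * h)%g <= word_length S g + word_length S h.
Proof.
have [v [vS <- <-]] := word_length_spelled g.
have [w [wS <- <-]] := word_length_spelled h.
rewrite -big_cat -size_cat; apply: word_length_le => s.
by rewrite mem_cat => /orP[/vS|/wS].
Qed.

Lemma word_lengthV (g : G) : word_length S g^-1%g <= word_length S g.
Proof.
have [w [wS <- <-]] := word_length_spelled g.
elim: w wS => [|s w IHw] wS; first by rewrite big_nil invg1 word_length1.
rewrite big_cons invgM /= -addn1; apply: (leq_trans (word_lengthM _ _)).
apply: leq_add; first by apply: IHw => t tw; apply: wS; rewrite inE tw orbT.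
by apply/word_length_mem/gen_S.1/wS; exact: mem_head.
Qed.

(** Follow a geodesic word for [g] from [v] in [V] to [v * g] outside [V]: the
    path leaves [V] at some letter, and the last point inside is in the
    boundary.  Each of the [|g|] letters accounts for at most [#|boundary V|]
    starting points, because right multiplication is injective. *)
Lemma escape_boundary (V : {fset G}) (g : G) :
  \sum_(v <- V) ((v * g)%g \notin V) <= word_length S g * #|` boundary S V|.
Proof.
have [w [wS <- <-]] := word_length_spelled g.
elim: w wS => [_|s w IHw wS].
  rewrite big_nil big_seq big1 // => v vV.
  by rewrite mulg1 vV.
have sS : s \in S by apply: wS; exact: mem_head.
have {}IHw := IHw (fun t tw => wS t (mem_behead (s := s :: w) tw)).
rewrite /= big_cons mulSn; set g' := (\prod_(t <- w) t)%g in IHw *.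
have le_split v : ((v * (s * g'))%g \notin V) <=
    ((v * s)%g \notin V) + ((v * s)%g \in V) * ((v * s * g')%g \notin V).
  by rewrite mulgA; case: (_ \in V); case: (_ \in V).
apply: leq_trans (leq_sum _ (fun v _ => le_split v)) _.
rewrite big_split /=; apply: leq_add.
  rewrite sum_bool_card.
  apply/fsubset_leq_card/fsubsetP => v; rewrite !inE => /andP[vV vs].
  rewrite vV /=; apply/asboolP; exists (v * s)%g => //.
  apply/eqP; rewrite /word_dist mulKg eqn_leq word_length_mem //= lt0n.
  by apply: contra vs => /eqP/word_length_eq0 ->; rewrite mulg1.
apply: leq_trans IHw.
under eq_bigr do rewrite mulnb.
rewrite !sum_bool_card.
set Vs := [fset v in V | _]%fset; set Vg := [fset v in V | _]%fset.
suff /fsubset_leq_card : ([fset (v * s)%g | v in Vs] `<=` Vg)%fset.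
  by rewrite card_imfset //; exact: mulIg.
apply/fsubsetP => u /imfsetP[v /=].
by rewrite !inE => /and3P[_ vs vsg] ->; rewrite vs vsg.
Qed.

End WordLength.
(** * Growth of an infinite group *)

Section Growth.
Variables (R : realType) (H : groupType).
Variable S : {fset H}.
Hypothesis gen_S : symmetric_generating S.

Definition ball (x : R) : {fset H} :=
  fset_set [set g | ((word_length S g)%:R <= x)%R]%classic.

Lemma mem_ball (x : R) (g : H) : (g \in ball x) = ((word_length S g)%:R <= x)%R.
Proof.
rewrite in_fset_set; last exact: finite_ball.
by apply/idP/idP; rewrite inE.
Qed.

(** If [g] has length in the interval from [2 x] (excluded) to [2 x + 1], then
    [ball x] and its translate by [g] are disjoint and lie in the ball of radius
    [3 x + 1 <= 4 x].  Such a [g] exists, for otherwise lengths could never pass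
    [2 x] letter by letter, and [H] would be a finite ball. *)
Lemma growth_doubling (x : R) : ~ finite_set [set: H]%classic -> (1 <= x)%R ->
  2 * growth S x <= growth S (4 * x)%R.
Proof.
move=> infH x1.
have [g [gx gx1]] : exists g,
    g \notin ball (2 * x)%R /\ g \in ball (2 * x + 1)%R.
  apply: contrapT => no_g; apply: infH.
  suff all_ball g : g \in ball (2 * x)%R.
    apply: sub_finite_set (finite_fset (ball (2 * x)%R)) => g _.
    exact: all_ball.
  have [w [wS <- _]] := word_length_spelled gen_S g.
  elim/last_ind: w wS => [|w s IHw] wS.
    by rewrite big_nil mem_ball word_length1 //; lra.
  apply: contrapT => /negP out; apply: no_g.
  exists (\prod_(t <- rcons w s) t)%g.
  split=> //; have wS' : {subset w <= S}.
    by move=> t tw; apply: wS; rewrite mem_rcons inE tw orbT.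
  have := IHw wS'; rewrite -cats1 big_cat big_seq1 !mem_ball => le2.
  have sS : s \in S by apply: wS; rewrite mem_rcons mem_head.
  have := leq_trans (word_lengthM gen_S (\prod_(t <- w) t)%g s)
    (leq_add (leqnn _) (word_length_mem gen_S sS)).
  by rewrite -(ler_nat R) natrD; move: le2; lra.
pose gB := [fset (g * h)%g | h in ball x]%fset.
have card_gB : #|` gB| = growth S x.
  by rewrite card_imfset //; exact: mulgI.
rewrite mul2n -addnn -{2}card_gB.
have disj : [disjoint ball x & gB]%fset.
  apply/fdisjointP => k kx; apply/imfsetP => -[/= h hx kE].
  move: gx; rewrite mem_ball -(mulgK h g) -kE => /negP; apply.
  have := leq_trans (word_lengthM gen_S k h^-1%g)
    (leq_add (leqnn _) (word_lengthV gen_S h)).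
  by rewrite -(ler_nat R) natrD; move: kx hx; rewrite !mem_ball; lra.
rewrite (_ : growth S x = #|` ball x|) // -cardfsUI.
move: disj; rewrite -fsetI_eq0 => /eqP ->; rewrite cardfs0 addn0.
apply/fsubset_leq_card/fsubsetP => k; rewrite in_fsetU !mem_ball.
move=> /orP[|]; first lra.
move=> /imfsetP[/= h]; rewrite mem_ball => hx ->.
have := word_lengthM gen_S g h.
by rewrite -(ler_nat R) natrD; move: gx1 hx; rewrite !mem_ball; lra.
Qed.

Lemma growth_mul16 (x : R) : ~ finite_set [set: H]%classic -> (1 <= x)%R ->
  16 * growth S x <= growth S (256 * x)%R.
Proof.
move=> infH x1.
have D (y : R) : (1 <= y)%R -> 2 * growth S y <= growth S (4 * y)%R.
  exact: growth_doubling infH.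
have D1 := D _ x1; have x4 : (1 <= 4 * x)%R by lra.
have D2 := D _ x4; have x16 : (1 <= 4 * (4 * x))%R by lra.
have D3 := D _ x16; have x64 : (1 <= 4 * (4 * (4 * x)))%R by lra.
have D4 := D _ x64.
rewrite (_ : 256 * x = 4 * (4 * (4 * (4 * x))))%R; last lra.
by move: D1 D2 D3 D4; lia.
Qed.

End Growth.
(** * Star swaps in the extension of the finitary symmetric group *)

Section StarSwaps.
Variable H : groupType.

Definition star_swap (h : H) : sym_ext H :=
  SDProd (translation H) (transp 1%g h) 1%g.

Definition shift (h : H) : sym_ext H := SDProd (translation H) 1%g h.

Lemma translate_transp (g a b : H) :
  translate g (transp a b) = transp (g * a)%g (g * b)%g.
Proof.
apply: finpermP => x /=; rewrite /transp_fun.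
have E y : ((g^-1 * x)%g == y) = (x == (g * y)%g).
  by apply/eqP/eqP => [<-|->]; rewrite ?mulVKg ?mulKg.
by rewrite !E; do 2?case: ifP => // _; rewrite mulVKg.
Qed.

Lemma mul_star_swap (v : sym_ext H) (h : H) :
  (v * star_swap h)%g =
  SDProd (translation H)
    (sd_fst v * transp (sd_snd v) (sd_snd v * h))%g (sd_snd v).
Proof. by congr SDProd; rewrite /= ?translate_transp mulg1. Qed.

Lemma star_swapK (h : H) : involutive (fun v : sym_ext H => v * star_swap h)%g.
Proof.
move=> [s x]; rewrite !mul_star_swap /= -mulgA; congr SDProd.
by apply: finpermP => y /=; rewrite transp_funK.
Qed.

(** Translating [(1 h)] by [s] gives [(s sh)], and conjugating that by [(1 s)]
    gives [(1 sh)].  Only one [star_swap h] occurs on the right, which is what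
    makes the length of star swaps linear; building [(1 hs)] from [(1 h)] and
    [(h hs)] would involve translations by [h] and a quadratic length.  The two
    excluded cases are those where conjugation moves [sh] as well. *)
Lemma star_swapM (s h : H) : h <> 1%g -> (s * h)%g <> 1%g ->
  star_swap (s * h)%g =
  (star_swap s * (shift s * star_swap h * shift s^-1) * star_swap s)%g.
Proof.
move=> h1 sh1.
have -> : (shift s * star_swap h * shift s^-1)%g =
    SDProd (translation H) (transp s (s * h)%g) 1%g.
  congr SDProd; rewrite /= ?translate_one ?translate_transp ?mulg1 ?mulgV //.
  by rewrite mul1g.
congr SDProd; rewrite /= ?mulg1 // !translate1.
have /eqP/negbTE hs1 : (s * h)%g <> s.
  by move=> sh; apply: h1; apply: (mulgI s); rewrite mulg1.
have := transpJ (transp 1%g s) s (s * h)%g.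
rewrite /= {1 2}/transp_fun; move/eqP/negbTE: sh1 => ->; rewrite hs1 eqxx.
have -> : (if s == 1%g then s else 1%g) = 1%g by case: eqP.
by move=> <-; congr (_ * _)%g; exact: finpermP.
Qed.

Lemma star_swap_length (S : {fset H}) (T : {fset sym_ext H}) :
    symmetric_generating S -> symmetric_generating T ->
  exists2 L, 0 < L &
    forall h, word_length T (star_swap h) <= L * word_length S h.
Proof.
move=> gS gT; pose len := word_length T.
pose cost s := len (star_swap s) + len (shift s) + len (shift s^-1%g)
  + len (star_swap s).
exists (\sum_(s <- S) cost s).+1 => // h; set L := _.+1.
have cost_le s : s \in S -> cost s <= L.
  by move=> sS; rewrite /L (big_fsetD1 s) //= leqW // leq_addr.
have [w [wS <- <-]] := word_length_spelled gS h.
elim: w wS => [|s w IHw] wS.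
  rewrite big_nil /star_swap transp1.
  by have := word_length1 gT; rewrite /sym_ext => ->.
have sS : s \in S by apply: wS; exact: mem_head.
have {}IHw := IHw (fun t tw => wS t (mem_behead (s := s :: w) tw)).
rewrite big_cons /= mulnS; set h' := (\prod_(t <- w) t)%g in IHw *.
have le_cost : len (star_swap s) <= cost s by apply: leq_addl.
have [h'1|/eqP h'1] := eqVneq h' 1%g.
  rewrite h'1 mulg1 (leq_trans le_cost) // (leq_trans (cost_le s sS)) //.
  exact: leq_addr.
have [sh'1|/eqP sh'1] := eqVneq (s * h')%g 1%g.
  by rewrite sh'1 /star_swap transp1 (word_length1 gT).
rewrite star_swapM //; apply: leq_trans (leq_add (cost_le s sS) IHw).
have M := word_lengthM gT.
rewrite /cost addnAC; apply: (leq_trans (M _ _)); apply: leq_add => //.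
rewrite -!addnA; apply: (leq_trans (M _ _)); apply: leq_add => //.
rewrite [X in _ + X]addnC addnA.
by apply: (leq_trans (M _ _)); apply: leq_add => //; exact: M.
Qed.

(** The fibre of [V] over the second coordinate of one of its points is stable
    in the same way as [V], and there star swaps act as transpositions with that
    coordinate as centre. *)
Lemma fact_le_star_swap (B : {fset H}) (d : nat) (V : {fset sym_ext H}) :
    1%g \notin B -> V != fset0 ->
    (forall v, v \in V -> d <= \sum_(h <- B) ((v * star_swap h)%g \in V)) ->
  d`! <= #|` V|.
Proof.
move=> B1 /fset0Pn[v0 v0V] degV; pose x := sd_snd v0.
pose W := [fset sd_fst v | v in [fset v in V | sd_snd v == x]]%fset.
have WE s : (s \in W) = (SDProd (translation H) s x \in V).
  apply/imfsetP/idP => [[[t y] /=]|sV].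
    by rewrite !inE /= => /andP[tV /eqP yx] ->; rewrite -yx.
  by exists (SDProd (translation H) s x); rewrite //= !inE /= sV eqxx.
have leWV : #|` W| <= #|` V|.
  apply: leq_trans (leq_imfset_card _ _ _) _.
  by apply/fsubset_leq_card/fsubsetP => v; rewrite !inE => /andP[].
apply: leq_trans leWV.
apply: (@fact_le_star _ x [fset (x * h)%g | h in B]%fset).
- apply: contra B1 => /imfsetP[h /= hB /esym xh].
  by have : h = 1%g by [apply: (mulgI x); rewrite mulg1] => <-.
- by apply/fset0Pn; exists (sd_fst v0); rewrite WE; case: v0 v0V @x {W WE}.
move=> s; rewrite WE => sV; apply: leq_trans (degV _ sV) _.
rewrite big_imfset /=; last by move=> ? ? _ _; exact: mulgI.
by apply: leq_sum => h _; rewrite WE mul_star_swap.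
Qed.

(** By [escape_boundary], the last hypothesis makes at least half of the pairs
    [(v, h)] stay in [V]; the average degree is then at least
    [#|B| / 2 >= 2 * d], as [min_inner_degree] requires. *)
Lemma fact_le_folner (T : {fset sym_ext H}) (V : {fset sym_ext H})
    (B : {fset H}) (d : nat) :
    symmetric_generating T -> V != fset0 -> 1%g \notin B -> 4 * d <= #|` B| ->
    2 * (\sum_(h <- B) word_length T (star_swap h)) * #|` boundary T V|
      <= #|` B| * #|` V| ->
  d`! <= #|` V|.
Proof.
move=> gT V0 B1 leB foV.
pose f h (v : sym_ext H) := (v * star_swap h)%g.
have total : \sum_(v <- V) inner_degree f B V v +
    \sum_(v <- V) \sum_(h <- B) ((v * star_swap h)%g \notin V) = #|` B| * #|` V|.
  rewrite -big_split /= [RHS]mulnC !card_fset_sum1 big_distrl /=.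
  apply: eq_bigr => v _; rewrite mul1n -big_split; apply: eq_bigr => h _.
  by rewrite /f; case: (_ \in V).
have escape : \sum_(v <- V) \sum_(h <- B) ((v * star_swap h)%g \notin V) <=
    (\sum_(h <- B) word_length T (star_swap h)) * #|` boundary T V|.
  rewrite exchange_big big_distrl /=; apply: leq_sum => h _.
  exact: escape_boundary.
have [|W [WV W0 degW]] := @min_inner_degree _ _ f B star_swapK d V V0.
  by have := leq_mul leB (leqnn #|` V|); move: total escape foV; lia.
exact: leq_trans (fact_le_star_swap B1 W0 degW) (fsubset_leq_card WV).
Qed.

End StarSwaps.
(** * The lower bound on the Folner function *)

Lemma growth_lt1 (R : realType) (H : groupType) (S : {fset H}) (x : R) :
  symmetric_generating S -> (0 < x < 1)%R -> growth S x = 1.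
Proof.
move=> gS /andP[x0 x1]; rewrite -[RHS](cardfs1 (1%g : H)); congr (#|` _|).
apply/fsetP => g; rewrite (mem_ball gS) inE.
apply/idP/eqP => [gx|->]; last by rewrite word_length1 // ltW.
apply: (word_length_eq0 gS); apply/eqP; rewrite -leqn0 -ltnS -(ltr_nat R).
exact: le_lt_trans gx x1.
Qed.

(** The radius [256 x] makes the ball at least 16 times larger than
    [k = growth S x], so that [4 * (2 * k)] star swaps remain after removing
    the neutral element; 512 is twice 256, to lose at most half of the pairs. *)
Lemma folner_lower_bound (R : realType) (H : groupType) (S : {fset H})
    (T V : {fset sym_ext H}) (L : nat) (x : R) :
    symmetric_generating S -> symmetric_generating T ->
    ~ finite_set [set: H]%classic ->
    (forall h, word_length T (star_swap h) <= L * word_length S h) ->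
    (1 <= x)%R -> V != fset0 ->
    (512 * L%:R * x * #|` boundary T V|%:R <= #|` V|%:R :> R)%R ->
  growth S x ^ growth S x <= #|` V|.
Proof.
move=> gS gT infH swapL x1 V0 foV; set k := growth S x.
apply: leq_trans (expn_le_fact_double k) _.
pose B := (ball S (256 * x)%R `\ 1%g)%fset.
have one_ball (y : R) : (0 <= y)%R -> 1%g \in ball S y.
  by rewrite mem_ball // word_length1.
have k0 : 0 < k.
  by rewrite cardfs_gt0; apply/fset0Pn; exists 1%g; apply: one_ball; lra.
have cardB : 16 * k <= #|` B|.+1.
  apply: leq_trans (growth_mul16 gS infH x1) _.
  rewrite -[growth _ _]/(#|` ball S _|) (cardfsD1 1%g) -/B one_ball //; lra.
apply: (@fact_le_folner _ T V B); rewrite ?inE ?eqxx //.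
  by move: cardB k0; lia.
rewrite -(ler_nat R) !natrM natr_sum.
have sumB : (\sum_(h <- B) (word_length T (star_swap h))%:R
    <= \sum_(h <- B) (L%:R * (256 * x)) :> R)%R.
  rewrite big_seq [leRHS]big_seq; apply: ler_sum => h.
  rewrite in_fsetD1 mem_ball // => /andP[_ hx].
  apply: le_trans (_ : (L * word_length S h)%:R <= _)%R.
    by rewrite ler_nat.
  by rewrite natrM ler_wpM2l.
move: sumB; rewrite big_const_seq count_predT iter_addr_0.
rewrite -[leRHS]mulr_natl => sumB.
apply: le_trans
  (_ : 2 * (#|` B|%:R * (L%:R * (256 * x))) * #|` boundary T V|%:R <= _)%R.
  by rewrite ler_wpM2r ?ler_wpM2l.
have := ler_wpM2l (ler0n R #|` B|) foV.
by apply: le_trans; rewrite le_eqVlt; apply/orP; left; apply/eqP; lra.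
Qed.

Theorem corollary1p4 (R : realType) (H : groupType)
    (S : {fset H}) (T : {fset sym_ext H}) :
  symmetric_generating S -> symmetric_generating T ->
  asymp_le (fun x : R => ((growth S x ^ growth S x)%N%:R%:E)%R)
           (fun x : R => folner T x).
Proof.
move=> gS gT.
have folner_ge1 (V : {fset sym_ext H}) : V != fset0 -> 1 <= #|` V|.
  by rewrite cardfs_gt0.
have [finH|infH] := pselect (finite_set [set: H]%classic).
  pose N := #|` fset_set [set: H]%classic|.
  have growthN (x : R) : growth S x <= N.
    apply/fsubset_leq_card/fsubsetP => g _; rewrite in_fset_set // inE //.
  have N0 : 0 < N.
    rewrite cardfs_gt0; apply/fset0Pn; exists 1%g.
    by rewrite in_fset_set // inE.
  have C0 : (0 < (N ^ N)%:R :> R)%R by rewrite ltr0n expn_gt0 N0.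
  exists (N ^ N)%:R%R, 1%R; split=> // x _.
  rewrite -lee_pdivrMl //; apply/ereal_infP => _ [V [V0 _] <-].
  rewrite -EFinM lee_fin ler_pdivrMl // -natrM ler_nat.
  apply: leq_trans (leq_pmulr _ (folner_ge1 _ V0)).
  apply: leq_trans (leq_pexp2l N0 (growthN x)).
  by have [->//|e0] := posnP (growth S x); rewrite leq_exp2r.
have [L L0 swapL] := star_swap_length gS gT.
exists 1%R, (512 * L%:R)%R; split=> //; first by rewrite mulr_gt0 // ltr0n.
move=> x x0; rewrite mul1e; apply/ereal_infP => _ [V [V0 foV] <-].
rewrite lee_fin ler_nat.
have [x1|x1] := leP 1%R x; last by rewrite growth_lt1 ?x0 ?folner_ge1.
apply: (folner_lower_bound gS gT infH swapL x1 V0).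
have V1 : (0 < #|` V|%:R :> R)%R by rewrite ltr0n folner_ge1.
have Kx : (0 < 512 * L%:R * x)%R by rewrite !mulr_gt0 // ltr0n.
by move: foV; rewrite ler_pdivrMr // mulrC ler_pdivlMr // mulrC.
Qed.
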